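(* Let $T\in B(H)$ be a contraction, i.e. $\|T\|\le 1$. Then $M_T(p)\le M(p)$ for every $p\in\mathbb{C}[z]$.
   Context: $H$ denotes a nonzero complex Hilbert space and $B(H)$ the set of all bounded linear operators on $H$. For $T\in B(H)$ and $h\in H$, $[h]$ denotes the closed linear span of $\{h,Th,T^2h,\dots\}$ (the closed invariant subspace of $T$ generated by $h$). For $e\in H$ and $p\in\mathbb{C}[z]$ put $$M_T^e(p)=\mathrm{dist}\big(p(T)e,[Tp(T)e]\big)=\inf_{q\in\mathbb{C}[z]}\big\|[I-q(T)T]\,p(T)e\big\|,\qquad M_T(p)=\sup_{e\in H,\ \|e\|=1}M_T^e(p).$$ The (classical) Mahler measure of a nonzero polynomial $p(z)=a_d\prod_{i=1}^d(z-\alpha_i)\in\mathbb{C}[z]$ (with $a_d\ne 0$) is $$M(p)=|a_d|\prod_{i=1}^d\max\{1,|\alpha_i|\}=\exp\Big[\frac{1}{2\pi}\int_{-\pi}^{\pi}\log|p(e^{i\theta})|\,d\theta\Big],$$ and $M(0)=0$. *)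

(* Defs.v *)
From HB Require Import structures.
From mathcomp Require Import all_boot all_order all_algebra.
From mathcomp Require Import sesquilinear.
From mathcomp Require Import complex.
From mathcomp Require Import all_classical all_reals all_analysis.

Set Implicit Arguments.
Unset Strict Implicit.
Unset Printing Implicit Defensive.

Import Order.TTheory GRing.Theory Num.Theory.
Import numFieldNormedType.Exports.

Local Open Scope classical_set_scope.
Local Open Scope ring_scope.

(* Norms over R[i] take their values in R[i] (on the nonnegative real axis);   *)
(* rnorm is the same norm read in R, where sup and inf are available.          *)
Definition rnorm (R : realType) (V : normedZmodType R[i]) (x : V) : R :=
  complex.Re `|x|.

Definition norm_of_dot (R : realType) (H : normedModType R[i])
    (dot : {dot H for Num.conj}) : Prop :=
  forall x : H, `|x| ^+ 2 = dot x x.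

Definition bounded_op (R : realType) (H : normedModType R[i]) (T : H -> H) :
    Prop :=
  exists M : R, forall x : H, rnorm (T x) <= M * rnorm x.

Definition op_norm (R : realType) (H : normedModType R[i]) (T : H -> H) : R :=
  sup [set rnorm (T x) | x in [set x : H | rnorm x <= 1]].

(* p(T) x *)
Definition poly_op (R : realType) (H : normedModType R[i]) (T : H -> H)
    (p : {poly R[i]}) (x : H) : H :=
  \sum_(i < size p) p`_i *: iter i T x.

(* [h]: the finite linear combinations of h, T h, T^2 h, ... are the q(T) h.   *)
Definition cyclic_subspace (R : realType) (H : normedModType R[i])
    (T : H -> H) (h : H) : set H :=
  closure [set poly_op T q h | q in [set: {poly R[i]}]].

Definition dist_to (R : realType) (H : normedModType R[i]) (x : H)
    (A : set H) : R :=
  inf [set rnorm (x - y) | y in A].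

Definition local_op_mahler (R : realType) (H : normedModType R[i])
    (T : H -> H) (e : H) (p : {poly R[i]}) : R :=
  dist_to (poly_op T p e) (cyclic_subspace T (T (poly_op T p e))).

Definition op_mahler (R : realType) (H : normedModType R[i]) (T : H -> H)
    (p : {poly R[i]}) : R :=
  sup [set local_op_mahler T e p | e in [set e : H | rnorm e = 1]].

(* The roots of p, with multiplicity; for p = 0 the value below is             *)
(* |lead_coef 0| * _ = 0.                                                      *)
Definition poly_roots (R : realType) (p : {poly R[i]}) : seq R[i] :=
  sval (closed_field_poly_normal p).

Definition mahler (R : realType) (p : {poly R[i]}) : R :=
  rnorm (lead_coef p) * \prod_(a <- poly_roots p) Num.max 1 (rnorm a).

Section facts.
Context {R : realType}.

Lemma rnormE (V : normedZmodType R[i]) (x : V) : (rnorm x)%:C%C = `|x|.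
Proof.
by rewrite /rnorm; have := normr_ge0 x; case: `|x| => a b; rewrite lecE /= => /andP[/eqP -> _].
Qed.

Lemma rnorm_ge0 (V : normedZmodType R[i]) (x : V) : 0 <= rnorm x.
Proof. by have := normr_ge0 x; rewrite -rnormE lecR. Qed.

Lemma ler_rnormD (V : normedZmodType R[i]) (x y : V) :
  rnorm (x + y) <= rnorm x + rnorm y.
Proof. by have := ler_normD x y; rewrite -!rnormE -rmorphD lecR. Qed.

Lemma rnormZ (H : normedModType R[i]) (a : R[i]) (x : H) :
  rnorm (a *: x) = rnorm a * rnorm x.
Proof.
by have := normrZ a x; rewrite -!rnormE -rmorphM => -[].
Qed.

Variable H : normedModType R[i].
Implicit Types (x e : H) (p q : {poly R[i]}) (A : set H).

Lemma has_inf_dist_to x A : A !=set0 ->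
  has_inf [set rnorm (x - y) | y in A].
Proof.
case=> a Aa; split; first by exists (rnorm (x - a)), a.
by exists 0 => _ [y _ <-]; exact: rnorm_ge0.
Qed.

Lemma dist_to_closure x A : dist_to x (closure A) = dist_to x A.
Proof.
have [->|A0] := eqVneq A set0; first by rewrite closure0.
have {}A0 : A !=set0 by apply/set0P.
have cA0 : closure A !=set0 by case: A0 => a Aa; exists a; exact: subset_closure.
apply/eqP; rewrite eq_le; apply/andP; split.
  apply: lb_le_inf; first by case: A0 => a Aa; exists (rnorm (x - a)), a.
  move=> _ [y Ay <-]; apply: ge_inf; first by case: (has_inf_dist_to x cA0).
  by exists y => //; exact: subset_closure.
apply: lb_le_inf; first by case: cA0 => a Aa; exists (rnorm (x - a)), a.
move=> _ [y cAy <-]; apply/ler_addgt0Pr => d d0.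
have dC0 : 0 < d%:C%C by rewrite ltcR.
have [z [Az]] := cAy _ (nbhsx_ballx y d%:C%C dC0).
rewrite -ball_normE /= -rnormE ltcR => yz.
apply: (@le_trans _ _ (rnorm (x - z))).
  apply: ge_inf; first by case: (has_inf_dist_to x A0).
  by exists z.
have -> : x - z = (x - y) + (y - z) by rewrite addrA subrK.
by rewrite (le_trans (ler_rnormD _ _))// lerD2l ltW.
Qed.

Lemma local_op_mahlerE (T : H -> H) e p :
  local_op_mahler T e p =
  inf [set rnorm (poly_op T p e - poly_op T q (T (poly_op T p e)))
      | q in [set: {poly R[i]}]].
Proof.
rewrite /local_op_mahler /cyclic_subspace dist_to_closure /dist_to.
by rewrite image_comp.
Qed.

Lemma has_sup_op_norm (T : {linear H -> H}) : bounded_op T ->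
  has_sup [set rnorm (T x) | x in [set x : H | rnorm x <= 1]].
Proof.
move=> [M TM]; split.
  by exists (rnorm (T 0)), 0 => //=; rewrite /rnorm normr0 ler01.
exists `|M| => _ [x /= x1 <-]; rewrite (le_trans (TM x))//.
rewrite (le_trans (ler_norm _))// normrM ler_piMr//.
by rewrite ger0_norm// rnorm_ge0.
Qed.

Lemma has_sup_op_mahler (T : {linear H -> H}) p : bounded_op T ->
  (exists h : H, h != 0) ->
  has_sup [set local_op_mahler T e p | e in [set e : H | rnorm e = 1]].
Proof.
move=> [M TM] [h h0].
have h0' : rnorm h != 0.
  by apply: contra_neq h0 => hE; apply/eqP; rewrite -normr_eq0 -rnormE hE.
split.
  exists (local_op_mahler T ((rnorm h)^-1%:C%C *: h) p).
  exists ((rnorm h)^-1%:C%C *: h) => //=.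
  rewrite rnormZ /rnorm normc_def/= expr0n addr0 sqrtr_sqr.
  by rewrite ger0_norm ?invr_ge0 ?rnorm_ge0// mulVf.
have iterM n x : rnorm (iter n T x) <= `|M| ^+ n * rnorm x.
  elim: n => [|n IH]; first by rewrite expr0 mul1r.
  rewrite iterS (le_trans (TM _))// (@le_trans _ _ (`|M| * rnorm (iter n T x)))//.
    by rewrite ler_wpM2r ?rnorm_ge0// ler_norm.
  by rewrite exprS -mulrA ler_wpM2l.
exists (\sum_(i < size p) rnorm p`_i * `|M| ^+ i) => _ [e /= e1 <-].
rewrite local_op_mahlerE.
apply: (@le_trans _ _ (rnorm (poly_op T p e))).
  apply: ge_inf; first by exists 0 => _ [q _ <-]; exact: rnorm_ge0.
  by exists 0 => //; rewrite {2}/poly_op size_poly0 big_ord0 subr0.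
rewrite /poly_op; elim/big_rec2 : _ => [|i y x _ IH].
  by rewrite /rnorm normr0.
rewrite (le_trans (ler_rnormD _ _))// lerD// rnormZ ler_wpM2l ?rnorm_ge0//.
by rewrite (le_trans (iterM _ _))// e1 mulr1.
Qed.

End facts.

(* Main.v *)
Require Import Defs.
From HB Require Import structures.
From mathcomp Require Import all_boot all_order all_algebra.
From mathcomp Require Import sesquilinear.
From mathcomp Require Import complex.
From mathcomp Require Import all_classical all_reals all_analysis.
From mathcomp Require Import ring lra.

Set Implicit Arguments.
Unset Strict Implicit.
Unset Printing Implicit Defensive.

Import Order.TTheory GRing.Theory Num.Theory.
Import numFieldNormedType.Exports.

Local Open Scope classical_set_scope.
Local Open Scope ring_scope.

(** Since f = 1 - q z runs over the polynomials with f(0) = 1, the local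
    measure of p at e is the infimum of |f(T) p(T) e| over such f.  On the unit
    circle, Jensen's formula says that the best f makes f p nearly of constant
    modulus M(p): f replaces each factor z - a of p by a multiple of a Blaschke
    factor if |a| < 1, and by the constant -a if |a| > 1.

    This can be done for one root at a time, and each step holds in operator
    form without dilation theory.  It is enough to find, for every root a and
    every t > max(1, |a|), a polynomial f with f(0) = 1 such that
    |(T - a) f(T) x| <= t |x| for all x: both conditions on f are stable under
    products, so the product of these f, one for each root, handles p
    ([multiplier_boundM], [multiplier_bound_mahler]).

    For one root, f is a truncated geometric series approximating (1 - b z)^-1
    for some |b| < 1.  The problem reduces to an inequality
    |(T - a) x| <= c |(1 - b T) x| with c < t ([multiplier_bound_neumann]), which
    follows from |T x| <= |x| by expanding squared norms.  For |a| < 1 it holds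
    with b the conjugate of a and c = 1 ([blaschke_le]).  For |a| >= 1, put
    u = T x / a, so that |u| <= |x|; then |u - x| <= 2 / (1 + r) |x - r u| for
    0 <= r < 1 ([contraction_sub1_le]), so that b = r / a and
    c = 2 |a| / (1 + r) are suitable once r is close to 1.  The number r is
    what keeps the geometric series convergent when |a| = 1. *)

(** * Polynomial calculus of a linear map *)

Section poly_op_calculus.
Context {R : realType} {H : normedModType R[i]}.
Variable T : {linear H -> H}.
Implicit Types (p q : {poly R[i]}) (x : H).

Lemma poly_op_widen n p x : (size p <= n)%N ->
  poly_op T p x = \sum_(i < n) p`_i *: iter i T x.
Proof.
move=> pn; rewrite /poly_op (big_ord_widen _ (fun i => p`_i *: iter i T x) pn).
rewrite big_mkcond; apply: eq_bigr => i _; case: ltnP => // pi.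
by rewrite nth_default// scale0r.
Qed.

Lemma poly_opD p q x : poly_op T (p + q) x = poly_op T p x + poly_op T q x.
Proof.
rewrite (poly_op_widen _ (size_polyD p q)).
rewrite (poly_op_widen _ (leq_maxl (size p) (size q))).
rewrite (poly_op_widen _ (leq_maxr (size p) (size q))) -big_split.
by apply: eq_bigr => i _; rewrite coefD scalerDl.
Qed.

Lemma poly_opZ a p x : poly_op T (a *: p) x = a *: poly_op T p x.
Proof.
rewrite (poly_op_widen _ (size_scale_leq a p)) scaler_sumr.
by apply: eq_bigr => i _; rewrite coefZ scalerA.
Qed.

Lemma poly_opB p q x : poly_op T (p - q) x = poly_op T p x - poly_op T q x.
Proof. by rewrite -(scaleN1r q) poly_opD poly_opZ scaleN1r. Qed.

Lemma poly_op1 x : poly_op T 1 x = x.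
Proof. by rewrite /poly_op size_poly1 big_ord1 coef1 scale1r. Qed.

Lemma poly_opMX p x : poly_op T (p * 'X) x = poly_op T p (T x).
Proof.
have sp : (size (p * 'X)%R <= (size p).+1)%N.
  by rewrite (leq_trans (size_polyMleq _ _))// size_polyX addn2.
rewrite (poly_op_widen _ sp) big_ord_recl coefMX/= scale0r add0r.
by apply: eq_bigr => i _; rewrite coefMX/= -iterS iterSr.
Qed.

Lemma poly_op_comm p x : poly_op T p (T x) = T (poly_op T p x).
Proof.
by rewrite linear_sum; apply: eq_bigr => i _; rewrite linearZ -iterS iterSr.
Qed.

Lemma poly_opM p q x : poly_op T (p * q) x = poly_op T p (poly_op T q x).
Proof.
elim/poly_ind: p x => [|p c IH] x.
  by rewrite mul0r /poly_op size_poly0 !big_ord0.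
rewrite mulrDl !poly_opD mul_polyC poly_opZ -mulrA -['X * q]mulrC mulrA.
by rewrite !poly_opMX IH poly_op_comm -[c%:P]alg_polyC poly_opZ poly_op1.
Qed.

Lemma poly_opX x : poly_op T 'X x = T x.
Proof. by rewrite -['X]mul1r poly_opMX poly_op1. Qed.

Lemma poly_opXn n x : poly_op T 'X^n x = iter n T x.
Proof.
elim: n x => [|n IH] x; first by rewrite expr0 poly_op1.
by rewrite exprSr poly_opMX IH -iterSr.
Qed.

End poly_op_calculus.

(** * Real-valued norms and the inner product *)

Lemma rnormM (R : realType) (a b : R[i]) : rnorm (a * b) = rnorm a * rnorm b.
Proof. exact: (@rnormZ R (R[i]^o : normedModType R[i]) a b). Qed.

Lemma rnormN (R : realType) (V : normedZmodType R[i]) (x : V) :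
  rnorm (- x) = rnorm x.
Proof. by rewrite /rnorm normrN. Qed.

Lemma rnorm1 (R : realType) : rnorm (1 : R[i]) = 1.
Proof. by rewrite /rnorm normr1. Qed.

Lemma rnormX (R : realType) (a : R[i]) n : rnorm (a ^+ n) = rnorm a ^+ n.
Proof. by elim: n => [|n IH]; rewrite ?rnorm1// !exprS rnormM IH. Qed.

Lemma rnormJ (R : realType) (a : R[i]) : rnorm (Num.conj a) = rnorm a.
Proof. by rewrite /rnorm norm_conjC. Qed.

Lemma rnorm_real (R : realType) (r : R) : 0 <= r -> rnorm r%:C%C = r.
Proof.
by move=> r0; rewrite /rnorm normc_def/= expr0n addr0 sqrtr_sqr ger0_norm.
Qed.

Lemma ReB (R : realType) (z w : R[i]) :
  complex.Re (z - w) = complex.Re z - complex.Re w.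
Proof. by case: z w => [a b] [c d]. Qed.

Lemma ReJ (R : realType) (z : R[i]) : complex.Re (Num.conj z) = complex.Re z.
Proof. by case: z. Qed.

Lemma ReZ (R : realType) (r : R) (z : R[i]) :
  complex.Re (r%:C%C * z) = r * complex.Re z.
Proof. by case: z => u v /=; rewrite mul0r subr0. Qed.

Lemma rnorm_sqrB (R : realType) (H : normedModType R[i])
    (dot : {dot H for Num.conj}) (x y : H) : norm_of_dot dot ->
  rnorm (x - y) ^+ 2 =
  rnorm x ^+ 2 + rnorm y ^+ 2 - 2 * complex.Re (dot x y).
Proof.
move=> Hdot.
have sq z : rnorm z ^+ 2 = complex.Re (dot z z).
  by rewrite -Hdot -rnormE -rmorphXn.
rewrite !sq linearBl !linearBr/= [dot y x]hermC expr0 mul1r.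
rewrite !ReB ReJ; ring.
Qed.

Lemma contraction_le (R : realType) (H : normedModType R[i])
    (T : {linear H -> H}) : bounded_op T -> op_norm T <= 1 ->
  forall x, rnorm (T x) <= rnorm x.
Proof.
move=> Tb T1 x; have [->|x0] := eqVneq x 0; first by rewrite linear0.
have rx0 : 0 < rnorm x by rewrite -ltcR rnormE normr_gt0.
have rk : rnorm (rnorm x)^-1%:C%C = (rnorm x)^-1.
  by rewrite rnorm_real// invr_ge0 rnorm_ge0.
have [_ ub] := has_sup_op_norm Tb.
have : rnorm (T ((rnorm x)^-1%:C%C *: x)) <= 1.
  apply: le_trans T1; apply: ub_le_sup => //.
  by exists ((rnorm x)^-1%:C%C *: x) => //=; rewrite rnormZ rk mulVf// gt_eqF.
by rewrite linearZ/= rnormZ rk ler_pdivrMl// mulr1.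
Qed.

(** * Bounds up to multipliers with constant term 1 *)

(** The least such c is the infimum, over the polynomials f with f(0) = 1, of
    the operator norm of f(T) p(T).  Quantifying over t > c avoids naming that
    infimum, which need not be attained (T the bilateral shift, p = z - 1,
    c = 1). *)
Definition multiplier_bound (R : realType) (H : normedModType R[i]) (T : H -> H)
    (p : {poly R[i]}) (c : R) : Prop :=
  forall t, c < t -> exists q : {poly R[i]},
    forall x, rnorm (poly_op T ((1 - q * 'X) * p) x) <= t * rnorm x.

Section bounds.
Context {R : realType} {H : normedModType R[i]}.
Variable T : {linear H -> H}.
Hypothesis T1 : forall x, rnorm (T x) <= rnorm x.
Implicit Types (p q : {poly R[i]}) (x : H).

Lemma rnorm_iter n x : rnorm (iter n T x) <= rnorm x.
Proof. by elim: n => //= n IH; exact: le_trans (T1 _) IH. Qed.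

Lemma multiplier_boundC a : multiplier_bound T a%:P (rnorm a).
Proof.
move=> t at_; exists 0 => x.
rewrite mul0r subr0 mul1r -alg_polyC poly_opZ poly_op1 rnormZ.
by rewrite ler_wpM2r ?rnorm_ge0// ltW.
Qed.

(** The multipliers 1 - f z and 1 - g z multiply to another multiplier with
    constant term 1, and operator norms are submultiplicative. *)
Lemma multiplier_boundM p q c d : 0 <= c -> 0 <= d ->
  multiplier_bound T p c -> multiplier_bound T q d ->
  multiplier_bound T (p * q) (c * d).
Proof.
move=> c0 d0 pc qd t cdt.
(* With e <= 1, (c + e) (d + e) <= c d + e (c + d + 1), and the second bound
   on e makes this at most t. *)
pose e := Num.min 1 ((t - c * d) / (c + d + 1)).
have s0 : 0 < c + d + 1 by lra.
have e0 : 0 < e by rewrite lt_min ltr01 divr_gt0// subr_gt0.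
have e1 : e <= 1 by rewrite ge_min lexx.
have es : e * (c + d + 1) <= t - c * d.
  by rewrite -ler_pdivlMr// ge_min lexx orbT.
have et : (c + e) * (d + e) <= t.
  have : e * e <= e * 1 by rewrite ler_wpM2l// ltW.
  by nra.
have [f fP] := pc (c + e) ltac:(lra).
have [g gP] := qd (d + e) ltac:(lra).
exists (f + g - f * g * 'X) => x.
have -> : (1 - (f + g - f * g * 'X) * 'X) * (p * q) =
    ((1 - f * 'X) * p) * ((1 - g * 'X) * q) by ring.
rewrite poly_opM (le_trans (fP _))//.
apply: (@le_trans _ _ ((c + e) * ((d + e) * rnorm x))).
  by rewrite ler_wpM2l// addr_ge0// ltW.
by rewrite mulrA ler_wpM2r// rnorm_ge0.
Qed.

(** If f is the sum of (b z)^k for k <= n, then (1 - b z) f = 1 - (b z)^(n+1);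
    so |(T - a) f(T) x| <= c |x - b^(n+1) T^(n+1) x| <= c (1 + |b|^(n+1)) |x|,
    which is at most t |x| for n large. *)
Lemma multiplier_bound_neumann a b c t : 0 <= c -> rnorm b < 1 -> c < t ->
    (forall x, rnorm (T x - a *: x) <= c * rnorm (x - b *: T x)) ->
  exists q, forall x,
    rnorm (poly_op T ((1 - q * 'X) * ('X - a%:P)) x) <= t * rnorm x.
Proof.
move=> c0 b1 ct ab.
have [n nP] : exists n, c * rnorm b ^+ n.+1 <= t - c.
  have c1 : 0 < c + 1 by lra.
  have e0 : 0 < (t - c) / (c + 1) by rewrite divr_gt0// subr_gt0.
  have b_lt1 : `|rnorm b| < 1 by rewrite ger0_norm// rnorm_ge0.
  have [n _ /(_ n (leqnn n))] := cvgr0_norm_lt _ (cvg_expr b_lt1) _ e0.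
  rewrite /= ger0_norm ?exprn_ge0 ?rnorm_ge0// ltr_pdivlMr// => nP.
  have b0 := rnorm_ge0 b; have bn0 : 0 <= rnorm b ^+ n by rewrite exprn_ge0.
  exists n; rewrite exprS; apply: le_trans (ltW nP).
  have : rnorm b * rnorm b ^+ n <= rnorm b ^+ n by rewrite ler_piMl// ltW.
  nra.
(* 1 - q 'X is the geometric sum of (b 'X)^k for k <= n. *)
pose S := \sum_(k < n) (b *: 'X) ^+ k : {poly R[i]}.
pose q := - (b *: S).
have qE : (1 - b *: 'X) * (1 - q * 'X) = 1 - (b *: 'X) ^+ n.+1.
  have := subrX1 (b *: 'X) n; rewrite -/S => SE.
  have -> : q * 'X = - (b *: 'X) * S by rewrite /q -!mul_polyC; ring.
  have -> : (1 - b *: 'X) * (1 - - (b *: 'X) * S) =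
    (1 - b *: 'X) - (b *: 'X) * ((b *: 'X - 1) * S) by ring.
  by rewrite -SE exprS; ring.
exists q => x.
have -> : (1 - q * 'X) * ('X - a%:P) = ('X - a%:P) * (1 - q * 'X).
  exact: mulrC.
rewrite poly_opM; set y := poly_op T (1 - q * 'X) x.
rewrite poly_opB poly_opX -alg_polyC poly_opZ poly_op1.
rewrite (le_trans (ab y))//.
have -> : y - b *: T y = poly_op T (1 - (b *: 'X) ^+ n.+1) x.
  by rewrite -qE poly_opM -/y poly_opB poly_op1 poly_opZ poly_opX.
rewrite poly_opB poly_op1 exprZn poly_opZ poly_opXn -scaleNr.
apply: (@le_trans _ _ (c * (rnorm x + rnorm b ^+ n.+1 * rnorm x))).
  rewrite ler_wpM2l// (le_trans (ler_rnormD _ _))// lerD2l rnormZ rnormN rnormX.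
  by rewrite ler_wpM2l ?exprn_ge0 ?rnorm_ge0 ?rnorm_iter.
have := rnorm_ge0 x; nra.
Qed.

End bounds.

(** * Linear factors *)

Section linear_factors.
Context {R : realType} {H : normedModType R[i]}.
Variables (dot : {dot H for Num.conj}) (T : {linear H -> H}).
Hypothesis Hdot : norm_of_dot dot.
Hypothesis T1 : forall x, rnorm (T x) <= rnorm x.

(** The cross terms of the two squared norms coincide, and the right one minus
    the left one is (1 - |a|^2) (|x|^2 - |T x|^2).  This is the operator form of
    |z - a| <= |1 - conj(a) z| on the unit disk. *)
Lemma blaschke_le a x : rnorm a < 1 ->
  rnorm (T x - a *: x) <= rnorm (x - Num.conj a *: T x).
Proof.
move=> a1; rewrite -ler_sqr ?nnegrE ?rnorm_ge0//.
rewrite !(rnorm_sqrB _ _ Hdot) !rnormZ rnormJ.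
have -> : complex.Re (dot (T x) (a *: x)) =
          complex.Re (dot x (Num.conj a *: T x)).
  rewrite !linearZr/= conjCK [dot (T x) x]hermC expr0 mul1r.
  by rewrite -rmorphM ReJ.
rewrite !exprMn.
have : rnorm a ^+ 2 <= 1 by rewrite expr_le1 ?rnorm_ge0 ?ltW.
have : rnorm (T x) ^+ 2 <= rnorm x ^+ 2.
  by rewrite ler_sqr ?nnegrE ?rnorm_ge0.
nra.
Qed.

(** The operator form of (1 + r) |w - 1| <= 2 |1 - r w| for |w| <= 1, with
    equality at w = -1.  The difference of the squares is a combination, with
    nonnegative coefficients, of |u + x|^2 and |x|^2 - |u|^2. *)
Lemma contraction_sub1_le (r : R) (u x : H) : 0 <= r <= 1 ->
  rnorm u <= rnorm x ->
  (1 + r) * rnorm (u - x) <= 2 * rnorm (x - r%:C%C *: u).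
Proof.
move=> /andP[r0 r1] ux.
rewrite -ler_sqr ?nnegrE ?mulr_ge0 ?addr_ge0 ?rnorm_ge0//.
rewrite !exprMn !(rnorm_sqrB _ _ Hdot) rnormZ.
rewrite rnorm_real//.
have -> : complex.Re (dot x (r%:C%C *: u)) = r * complex.Re (dot u x).
  by rewrite linearZr/= [dot x u]hermC expr0 mul1r -rmorphM ReJ ReZ.
set s := complex.Re _; rewrite exprMn.
have s_ge : 0 <= rnorm u ^+ 2 + rnorm x ^+ 2 + 2 * s.
  have := sqr_ge0 (rnorm (u - - x)).
  rewrite (rnorm_sqrB _ _ Hdot) linearNr/=.
  by rewrite rnormN raddfN/= mulrN opprK.
have : rnorm u ^+ 2 <= rnorm x ^+ 2.
  by rewrite ler_sqr ?nnegrE ?rnorm_ge0.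
move: s_ge; set U := rnorm u ^+ 2; set X := rnorm x ^+ 2 => s_ge UX.
rewrite -subr_ge0.
have -> : 2 ^+ 2 * (X + r ^+ 2 * U - 2 * (r * s)) -
    (1 + r) ^+ 2 * (U + X - 2 * s) =
  (1 - r) ^+ 2 * (U + X + 2 * s) + 2 * (1 - r) * (1 + r) * (X - U) by ring.
by rewrite addr_ge0 ?mulr_ge0 ?sqr_ge0// ?subr_ge0// addr_ge0.
Qed.

Lemma multiplier_boundXsubC a :
  multiplier_bound T ('X - a%:P) (Num.max 1 (rnorm a)).
Proof.
move=> t; rewrite gt_max => /andP[t1 at_].
have [a1|a1] := ltP (rnorm a) 1.
  apply: (@multiplier_bound_neumann _ _ _ T1 a (Num.conj a) 1) => //.
    by rewrite rnormJ.
  by move=> x; rewrite mul1r; exact: blaschke_le.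
have t0 : 0 < t by lra.
have a0 : 0 < rnorm a by lra.
have aN0 : a != 0 by apply: contraTneq a0 => ->; rewrite /rnorm normr0 ltxx.
(* This r is below 1, and 2 |a| / (1 + r) = 2 |a| t / (t + |a|) < t. *)
pose r := rnorm a / t.
have r0 : 0 <= r by rewrite divr_ge0// ltW.
have r1 : r < 1 by rewrite ltr_pdivrMr// mul1r.
have rE : r * t = rnorm a by rewrite divfK// gt_eqF.
have rV : rnorm a^-1 = (rnorm a)^-1.
  apply: (mulfI (lt0r_neq0 a0)).
  by rewrite -rnormM !divff ?rnorm1// lt0r_neq0.
apply: (@multiplier_bound_neumann _ _ _ T1 a (r%:C%C * a^-1)
         (rnorm a * (2 / (1 + r)))).
- by rewrite mulr_ge0 ?rnorm_ge0// divr_ge0// addr_ge0.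
- rewrite rnormM rV rnorm_real// ltr_pdivrMr// mul1r; lra.
- rewrite mulrA ltr_pdivrMr; last lra.
  nra.
move=> x; have -> : T x - a *: x = a *: (a^-1 *: T x - x).
  by rewrite scalerBr scalerA divff// scale1r.
rewrite rnormZ -mulrA ler_wpM2l ?rnorm_ge0// -scalerA.
rewrite mulrAC ler_pdivlMr; last lra.
rewrite mulrC; apply: contraction_sub1_le; first by rewrite r0 ltW.
rewrite rnormZ rV ler_pdivrMl//; apply: le_trans (T1 x) _.
by rewrite ler_peMl// rnorm_ge0.
Qed.

Lemma multiplier_bound_mahler p : multiplier_bound T p (mahler p).
Proof.
rewrite {1}(svalP (closed_field_poly_normal p)) /mahler -/(poly_roots p).
rewrite -mul_polyC; apply: multiplier_boundM => //.
- exact: rnorm_ge0.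
- by apply: prodr_ge0 => a _; rewrite le_max ler01.
- exact: multiplier_boundC.
elim: (poly_roots p) => [|a s IH].
  by rewrite !big_nil -[X in multiplier_bound _ _ X](rnorm1 R);
    exact: multiplier_boundC.
rewrite !big_cons; apply: multiplier_boundM => //.
- by rewrite le_max ler01.
- by apply: prodr_ge0 => b _; rewrite le_max ler01.
exact: multiplier_boundXsubC.
Qed.

End linear_factors.

Theorem theorem2p3 (R : realType) (H : completeNormedModType R[i])
    (dot : {dot H for Num.conj}) (Hdot : norm_of_dot dot)
    (H_neq0 : exists h : H, h != 0)
    (T : {linear H -> H}) (T_bounded : bounded_op T)
    (T_contraction : op_norm T <= 1) (p : {poly R[i]}) :
  op_mahler T p <= mahler p.
Proof.
have T1 := contraction_le T_bounded T_contraction.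
apply: ge_sup; first by case: (has_sup_op_mahler p T_bounded H_neq0).
move=> _ [e /= e1 <-]; rewrite local_op_mahlerE.
apply/ler_addgt0Pr => d d0.
have [q qP] : exists q, forall x,
    rnorm (poly_op T ((1 - q * 'X) * p) x) <= (mahler p + d) * rnorm x.
  by apply: (multiplier_bound_mahler Hdot T1); rewrite ltrDl.
apply: le_trans (_ : rnorm (poly_op T ((1 - q * 'X) * p) e) <= _).
  apply: ge_inf; first by exists 0 => _ [? _ <-]; exact: rnorm_ge0.
  exists q => //; congr rnorm.
  by rewrite poly_opM poly_opB poly_op1 poly_opMX.
by rewrite (le_trans (qP e))// e1 mulr1.
Qed.
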